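(* Let $\mathcal{C}\le \mathbb{F}_q^{n\times m}$ be a rank-metric code of dimension $k$, and let $P_{\mathcal C}=(E,\rho_{\mathcal C})$ be its associated $(q,m)$-polymatroid. Then for every integer $1\le r\le k$, $$\mathrm{Min}\{\mathrm{Supp}(\mathcal D)\mid \mathcal D\le \mathcal C,\ \dim\mathcal D=r\}=\mathscr{C}^{\ast}\bigl(P_{\mathcal C}^{(r-1)}\bigr),$$ i.e. the inclusion-minimal higher rank-supports of $r$-dimensional subcodes of $\mathcal C$ are exactly the circuits of the dual of the $(r-1)$-th truncation of $P_{\mathcal C}$.
   Context: $q$ is a prime power, $n,m$ positive integers, $E=\mathbb{F}_q^n$ (column vectors), $\mathcal L(E)$ the set of all $\mathbb F_q$-subspaces of $E$. A rank-metric code is an $\mathbb F_q$-subspace $\mathcal C$ of $\mathbb F_q^{n\times m}$; subcodes are its $\mathbb F_q$-subspaces. For $M\in\mathcal C$, $\mathrm{supp}(M)$ is the column space of $M$; for a subcode $\mathcal D$, $\mathrm{Supp}(\mathcal D)=\sum_{M\in\mathcal D}\mathrm{supp}(M)$. For $J\le E$, $\mathcal C(J)=\{M\in\mathcal C\mid \mathrm{supp}(M)\subseteq J\}$ and $J^\perp$ is the orthogonal complement with respect to the standard dot product on $E$. $\rho_{\mathcal C}(J)=\dim\mathcal C-\dim \mathcal C(J^\perp)$ and $P_{\mathcal C}=(E,\rho_{\mathcal C})$. A $(q,m)$-polymatroid is a pair $P=(E,\rho)$ with $\rho:\mathcal L(E)\to\mathbb Z_{\ge0}$ satisfying: $0\le\rho(A)\le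 m\dim A$; $A\le B\Rightarrow \rho(A)\le\rho(B)$; $\rho(A+B)+\rho(A\cap B)\le\rho(A)+\rho(B)$. A subspace $I$ is independent if $\rho(I)=m\dim I$, otherwise dependent; a circuit is a dependent subspace all of whose proper subspaces are independent. The dual of $P$ is $P^\ast=(E,\rho^\ast)$ with $\rho^\ast(J)=\rho(J^\perp)+m\dim J-\rho(E)$, and $\mathscr C^\ast(P)$ denotes the set of circuits of $P^\ast$. For $0\le t\le \rho(E)$, the $t$-th truncation is $P^{(t)}=(E,\rho^{(t)})$ with $\rho^{(t)}(J)=\min\{\rho(J),\rho(E)-t\}$. $\mathrm{Min}(\mathcal A)$ denotes the inclusion-minimal members of a family $\mathcal A$. *)

(* Defs.v *)
From HB Require Import structures.
From mathcomp Require Import all_boot all_order all_algebra.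
From mathcomp Require Import zify.

Set Implicit Arguments.
Unset Strict Implicit.
Unset Printing Implicit Defensive.

Import GRing.Theory.
Local Open Scope ring_scope.

(* The field F_q is an arbitrary [F : finFieldType] (q = #|F|), E = F_q^n is
   ['cV[F]_n], and subspaces of E and of F_q^(n x m) are [{vspace _}]. *)

Lemma mem_span_enum (F : finFieldType) (n m : nat) (P : pred 'M[F]_(n, m)) :
    P 0 -> (forall (a : F) u v, P u -> P v -> P (a *: u + v)) ->
  forall x, (x \in <<enum P>>%VS) = P x.
Proof.
move=> P0 Plin x; apply/idP/idP => [xP | Px]; last first.
  by apply: memv_span; rewrite mem_enum.
have := coord_span (X := in_tuple (enum P)) xP => ->.
apply: (big_ind P) => // [u v Pu Pv | i _].
  by rewrite -[u]scale1r; apply: Plin.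
rewrite -[_ *: _]addr0; apply: Plin => //.
have iP : (in_tuple (enum P))`_i \in enum P by apply: mem_nth.
by rewrite mem_enum in iP.
Qed.

Section Orthogonal.
Variables (F : finFieldType) (n : nat).
Implicit Types (x y : 'cV[F]_n) (A B J : {vspace 'cV[F]_n}).

Definition dot x y : F := \sum_(i < n) x i 0 * y i 0.

(* The span is that of a set which already is a subspace: see [mem_orthov]. *)
Definition orthov J : {vspace 'cV[F]_n} :=
  <<enum [pred x : 'cV[F]_n | [forall y in J, (dot x y == 0)%R]]>>%VS.

Lemma dotDZl a x x' y : dot (a *: x + x') y = a * dot x y + dot x' y.
Proof.
rewrite /dot mulr_sumr -big_split; apply: eq_bigr => i _ /=.
by rewrite !mxE mulrDl mulrA.
Qed.

Lemma dotC x y : dot x y = dot y x.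
Proof. by apply: eq_bigr => i _; rewrite mulrC. Qed.

Lemma dot0l y : dot 0 y = 0.
Proof. by rewrite /dot big1 // => i _; rewrite mxE mul0r. Qed.

Lemma mem_orthov J x : (x \in orthov J) = [forall y in J, dot x y == 0].
Proof.
rewrite /orthov mem_span_enum //= => [|a u v /forall_inP Hu /forall_inP Hv].
  by apply/forall_inP => y _; rewrite dot0l.
apply/forall_inP => y yJ.
by rewrite dotDZl (eqP (Hu y yJ)) (eqP (Hv y yJ)) mulr0 addr0.
Qed.

Lemma orthovP J x : reflect {in J, forall y, dot x y = 0} (x \in orthov J).
Proof.
rewrite mem_orthov.
by apply: (iffP forall_inP) => H y yJ; apply/eqP; [apply: H | rewrite H].
Qed.

Lemma orthovS A B : (A <= B)%VS -> (orthov B <= orthov A)%VS.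
Proof.
move=> /subvP AB; apply/subvP => x /orthovP xB.
by apply/orthovP => y /AB; apply: xB.
Qed.

Lemma orthovD A B : orthov (A + B) = (orthov A :&: orthov B)%VS.
Proof.
apply/eqP; rewrite eqEsubv subv_cap !orthovS ?addvSl ?addvSr //=.
apply/subvP => x; rewrite memv_cap => /andP[/orthovP xA /orthovP xB].
apply/orthovP => y /memv_addP[a aA [b bB ->]].
by rewrite dotC -[a]scale1r dotDZl !(dotC _ x) xA // xB // mulr0 addr0.
Qed.

Definition basis_rows J : 'M[F]_(\dim J, n) :=
  \matrix_(i < \dim J, j < n) (vbasis J)`_i j 0.

Lemma basis_rowsE J m (M : 'M[F]_(n, m)) i j :
  (basis_rows J *m M) i j = dot (vbasis J)`_i (col j M).
Proof. by rewrite mxE; apply: eq_bigr => k _; rewrite !mxE. Qed.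

Lemma orthov_basis J m (M : 'M[F]_(n, m)) :
  reflect (forall j, col j M \in orthov J) (basis_rows J *m M == 0).
Proof.
apply: (iffP eqP) => [M0 j | HM].
  apply/orthovP => y yJ; rewrite (coord_vbasis yJ).
  apply: (big_ind (fun z => dot (col j M) z = 0)) => [|u v Hu Hv|i _].
  - by rewrite dotC dot0l.
  - by rewrite -[u]scale1r dotC dotDZl !(dotC _ (col j M)) Hu Hv mulr0 addr0.
  - rewrite -[_ *: _]addr0 dotC dotDZl dot0l addr0.
    by rewrite -basis_rowsE M0 mxE mulr0.
apply/matrixP => i j; rewrite basis_rowsE mxE dotC.
by apply: (orthovP _ _ (HM j)); apply/vbasis_mem/mem_nth; rewrite size_tuple.
Qed.

Lemma basis_rows_free J : row_free (basis_rows J).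
Proof.
apply: inj_row_free => v v0; apply/rowP => i; rewrite mxE.
have /freeP -> // := basis_free (vbasisP J).
apply/colP => j; rewrite summxE [RHS]mxE.
have /= := congr1 (fun w : 'rV_n => w 0 j) v0; rewrite !mxE => vj0.
rewrite -[RHS]vj0; apply: eq_bigr => k _.
by rewrite !mxE.
Qed.

Lemma dim_orthov J : (\dim (orthov J) + \dim J)%N = n.
Proof.
pose f := linfun (mulmx (basis_rows J) : 'cV[F]_n -> 'cV[F]_(\dim J)).
have -> : orthov J = (fullv :&: lker f)%VS.
  apply/vspaceP => x; rewrite memv_cap memvf /= memv_ker lfunE /=.
  apply/idP/idP => [xJ | /orthov_basis/(_ 0)]; last by rewrite col_id.
  by apply/orthov_basis => j; rewrite ord1 col_id.
have fE : (f @: fullv)%VS = fullv.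
  apply/eqP; rewrite eqEsubv subvf /=; apply/subvP => y _.
  have /row_freeP[B' BB'] := basis_rows_free J.
  have -> : y = f (B' *m y) by rewrite lfunE /= mulmxA BB' mul1mx.
  by apply/memv_img/memvf.
have dE p : \dim {:'cV[F]_p} = p by rewrite dimvf; exact: muln1.
by have := limg_ker_dim f fullv; rewrite fE !dE.
Qed.

Lemma orthovK J : orthov (orthov J) = J.
Proof.
apply/esym/eqP; rewrite eqEdim; apply/andP; split.
  by apply/subvP => x xJ; apply/orthovP => y /orthovP/(_ x xJ); rewrite dotC.
by have := dim_orthov J; have := dim_orthov (orthov J); lia.
Qed.

Lemma orthovI A B : orthov (A :&: B) = (orthov A + orthov B)%VS.
Proof. by rewrite -[RHS]orthovK orthovD !orthovK. Qed.

End Orthogonal.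

Record qm_polymatroid (F : finFieldType) (n m : nat) := QMPolymatroid {
  rk :> {vspace 'cV[F]_n} -> nat;
  rk_le_dim : forall A, (rk A <= m * \dim A)%N;
  rk_mono : forall A B, (A <= B)%VS -> (rk A <= rk B)%N;
  rk_submod : forall A B, (rk (A + B)%VS + rk (A :&: B)%VS <= rk A + rk B)%N
}.

Section Polymatroids.
Variables (F : finFieldType) (n m : nat).
Implicit Types (P : qm_polymatroid F n m) (A B I J : {vspace 'cV[F]_n}).

Definition independent P I : Prop := rk P I = (m * \dim I)%N.

Definition circuit P I : Prop :=
  ~ independent P I /\
  forall J, (J <= I)%VS -> J != I -> independent P J.

(* The subtraction is exact: see [rk_dual_ge]. *)
Definition dual_rk P J : nat :=
  (rk P (orthov J) + m * \dim J - rk P fullv)%N.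

Lemma rk_orthov_le P A B : (A <= B)%VS ->
  (rk P (orthov A) + m * \dim A <= rk P (orthov B) + m * \dim B)%N.
Proof.
move=> AB; have sBA := orthovS AB.
pose W := (orthov A :\: orthov B)%VS.
have eqA : (W + orthov B)%VS = orthov A.
  by rewrite addv_diff; apply/addv_idPl.
have dW := dimv_cap_compl (orthov A) (orthov B).
rewrite (capv_idPr sBA) -/W in dW.
have := rk_submod P W (orthov B); rewrite eqA.
have := rk_le_dim P W; have := dim_orthov A; have := dim_orthov B.
have -> : \dim W = (\dim (orthov A) - \dim (orthov B))%N by lia.
by have := dimvS AB; have := dimvS sBA; nia.
Qed.

Lemma orthov0 : orthov 0%VS = fullv :> {vspace 'cV[F]_n}.
Proof.
apply/eqP; rewrite eqEsubv subvf; apply/subvP => x _; apply/orthovP => y.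
by rewrite memv0 => /eqP ->; rewrite dotC dot0l.
Qed.

Lemma rk_dual_ge P J : (rk P fullv <= rk P (orthov J) + m * \dim J)%N.
Proof. by have := rk_orthov_le P (sub0v J); rewrite orthov0 dimv0; lia. Qed.

Fact dual_rk_le_dim P A : (dual_rk P A <= m * \dim A)%N.
Proof. by rewrite /dual_rk; have := rk_mono P (subvf (orthov A)); lia. Qed.

Fact dual_rk_mono P A B : (A <= B)%VS -> (dual_rk P A <= dual_rk P B)%N.
Proof. by move=> AB; apply/leq_sub2r/rk_orthov_le. Qed.

Fact dual_rk_submod P A B :
  (dual_rk P (A + B)%VS + dual_rk P (A :&: B)%VS
     <= dual_rk P A + dual_rk P B)%N.
Proof.
rewrite /dual_rk.
have := rk_dual_ge P A; have := rk_dual_ge P B.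
have := rk_dual_ge P (A + B)%VS; have := rk_dual_ge P (A :&: B)%VS.
rewrite orthovD orthovI.
have := rk_submod P (orthov A) (orthov B); have := dimv_sum_cap A B.
by nia.
Qed.

Definition dual P : qm_polymatroid F n m :=
  QMPolymatroid (dual_rk_le_dim P) (@dual_rk_mono P) (dual_rk_submod P).

(* Meaningful for t <= rk P fullv, where the subtraction is exact. *)
Definition trunc_rk P (t : nat) J : nat := minn (rk P J) (rk P fullv - t).

Fact trunc_rk_le_dim P t A : (trunc_rk P t A <= m * \dim A)%N.
Proof. exact: leq_trans (geq_minl _ _) (rk_le_dim P A). Qed.

Fact trunc_rk_mono P t A B :
  (A <= B)%VS -> (trunc_rk P t A <= trunc_rk P t B)%N.
Proof. by move=> /(rk_mono P); rewrite /trunc_rk; lia. Qed.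

Fact trunc_rk_submod P t A B :
  (trunc_rk P t (A + B)%VS + trunc_rk P t (A :&: B)%VS
     <= trunc_rk P t A + trunc_rk P t B)%N.
Proof.
rewrite /trunc_rk.
have := rk_submod P A B.
have := rk_mono P (capvSl A B); have := rk_mono P (capvSr A B).
by lia.
Qed.

Definition truncation P (t : nat) : qm_polymatroid F n m :=
  QMPolymatroid (trunc_rk_le_dim P t) (@trunc_rk_mono P t)
                (trunc_rk_submod P t).

End Polymatroids.

Section RankMetricCodes.
Variables (F : finFieldType) (n m : nat).
Implicit Types (M : 'M[F]_(n, m)) (C D : {vspace 'M[F]_(n, m)}).
Implicit Types (A B J X Y : {vspace 'cV[F]_n}).

Definition supp M : {vspace 'cV[F]_n} := <<[seq col j M | j : 'I_m]>>%VS.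

Definition Supp D : {vspace 'cV[F]_n} := (\sum_(M | M \in D) supp M)%VS.

(* C(J); again the span of a set which is a subspace: see [mem_shorten]. *)
Definition shorten C J : {vspace 'M[F]_(n, m)} :=
  <<enum [pred M : 'M[F]_(n, m) | (M \in C) && (supp M <= J)%VS]>>%VS.

Lemma supp_subP M J : reflect (forall j, col j M \in J) (supp M <= J)%VS.
Proof.
apply: (iffP span_subvP) => [H j | H _ /mapP[j _ ->]]; last exact: H.
by apply: H; apply: map_f; rewrite mem_enum.
Qed.

Lemma mem_shorten C J M :
  (M \in shorten C J) = (M \in C) && (supp M <= J)%VS.
Proof.
rewrite /shorten mem_span_enum //= => [|a u v].
  rewrite mem0v; apply/supp_subP => j.
  by have -> : col j (0 : 'M[F]_(n, m)) = 0 by [apply/colP => i; rewrite !mxE]; rewrite mem0v.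
move=> /andP[uC /supp_subP uJ] /andP[vC /supp_subP vJ].
rewrite memvD ?memvZ //=; apply/supp_subP => j.
have -> : col j (a *: u + v) = a *: col j u + col j v.
  by apply/colP => i; rewrite !mxE.
by rewrite memvD ?memvZ.
Qed.

Lemma shorten_sub C J : (shorten C J <= C)%VS.
Proof. by apply/subvP => M; rewrite mem_shorten => /andP[]. Qed.

Lemma shortenS C A B : (A <= B)%VS -> (shorten C A <= shorten C B)%VS.
Proof.
move=> AB; apply/subvP => M; rewrite !mem_shorten => /andP[-> MA] /=.
exact: subv_trans MA AB.
Qed.

Lemma shortenI C A B :
  shorten C (A :&: B) = (shorten C A :&: shorten C B)%VS.
Proof.
apply/vspaceP => M; rewrite memv_cap !mem_shorten subv_cap.
by case: (M \in C).
Qed.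

(* The subtraction is exact, by [shorten_sub]. *)
Definition code_rk C J : nat := (\dim C - \dim (shorten C (orthov J)))%N.

Fact code_rk_le_dim C A : (code_rk C A <= m * \dim A)%N.
Proof.
pose f := linfun (mulmx (basis_rows A) : 'M[F]_(n, m) -> 'M[F]_(\dim A, m)).
have -> : code_rk C A = \dim (f @: C)%VS.
  rewrite /code_rk -(limg_ker_dim f C).
  suff -> : shorten C (orthov A) = (C :&: lker f)%VS by rewrite addKn.
  apply/vspaceP => M; rewrite memv_cap mem_shorten memv_ker lfunE /=.
  congr (_ && _); apply/idP/idP => [/supp_subP | /orthov_basis] H.
    exact/orthov_basis.
  exact/supp_subP.
by have := dimvS (subvf (f @: C)%VS); rewrite dimvf mulnC.
Qed.

Fact code_rk_mono C A B : (A <= B)%VS -> (code_rk C A <= code_rk C B)%N.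
Proof. by move=> AB; apply/leq_sub2l/dimvS/shortenS/orthovS. Qed.

Fact code_rk_submod C A B :
  (code_rk C (A + B)%VS + code_rk C (A :&: B)%VS
     <= code_rk C A + code_rk C B)%N.
Proof.
rewrite /code_rk.
have dC J : (\dim (shorten C (orthov J)) <= \dim C)%N.
  exact/dimvS/shorten_sub.
have := dC A; have := dC B; have := dC (A + B)%VS.
have := dC (A :&: B)%VS; rewrite orthovD shortenI.
have := dimv_sum_cap (shorten C (orthov A)) (shorten C (orthov B)).
have : (\dim (shorten C (orthov A) + shorten C (orthov B))
          <= \dim (shorten C (orthov (A :&: B))))%N.
  by apply: dimvS; rewrite subv_add !shortenS ?orthovS ?capvSl ?capvSr.
by lia.
Qed.

Definition code_polymatroid C : qm_polymatroid F n m :=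
  QMPolymatroid (code_rk_le_dim C) (@code_rk_mono C) (code_rk_submod C).

Definition Min (S : {vspace 'cV[F]_n} -> Prop) X : Prop :=
  S X /\ forall Y, S Y -> (Y <= X)%VS -> Y = X.

Definition subcode_supports C (r : nat) X : Prop :=
  exists D, [/\ (D <= C)%VS, \dim D = r & Supp D = X].

End RankMetricCodes.

(* Main.v *)
(* Orthogonality turns independence in the dual of the (r-1)-th truncation into
   a dimension count: J is dependent there exactly when dim C(J) >= r, that is,
   when J contains the support of an r-dimensional subcode.  Circuits are the
   minimal dependent subspaces, hence the minimal such supports. *)
From mathcomp Require Import all_boot all_order all_algebra.
From mathcomp Require Import zify.
Require Import Defs.

Lemma vspace_of_dim (K : fieldType) (vT : vectType K) (U : {vspace vT}) r :
  (r <= \dim U)%N -> exists2 D : {vspace vT}, (D <= U)%VS & \dim D = r.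
Proof.
move=> le_rU; exists <<take r (vbasis U)>>%VS.
  by apply/span_subvP => v /mem_take; apply: vbasis_mem.
have := basis_free (vbasisP U).
rewrite -{1}(cat_take_drop r (vbasis U)) => /catl_free/eqP ->.
by rewrite size_takel ?size_tuple.
Qed.

Section HigherSupports.
Variables (F : finFieldType) (n m : nat).
Implicit Types (C D : {vspace 'M[F]_(n, m)}) (J X : {vspace 'cV[F]_n}).

(** [Supp] and [shorten C] form a Galois connection: a sum of supports lies in [J] exactly when each
    summand does. *)
Lemma sub_shorten C D J :
  (D <= shorten C J)%VS = (D <= C)%VS && (Supp D <= J)%VS.
Proof.
apply/idP/andP => [/subvP DCJ | [/subvP DC /subv_sumP DJ]].
  split; first by apply/subvP => M /DCJ; rewrite mem_shorten => /andP[].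
  by apply/subv_sumP => M /DCJ; rewrite mem_shorten => /andP[].
by apply/subvP => M MD; rewrite mem_shorten DC // DJ.
Qed.

Lemma shorten0 C : shorten C 0 = 0%VS.
Proof.
apply/eqP; rewrite -subv0; apply/subvP => M.
rewrite mem_shorten memv0 => /andP[_ /supp_subP M0].
apply/eqP/matrixP => i j; have := M0 j; rewrite memv0 => /eqP/colP/(_ i).
by rewrite !mxE.
Qed.

Lemma orthov_full : orthov fullv = 0%VS :> {vspace 'cV[F]_n}.
Proof. by rewrite -orthov0 orthovK. Qed.

Lemma code_rk_full C : code_rk C fullv = \dim C.
Proof. by rewrite /code_rk orthov_full shorten0 dimv0 subn0. Qed.

(** The terms [m * \dim J] cancel, the subtraction in [dual_rk] being exact by [rk_dual_ge]. *)
Lemma dual_independentE (P : qm_polymatroid F n m) J :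
  independent (dual P) J <-> rk P (orthov J) = rk P fullv.
Proof.
rewrite /independent /= /dual_rk.
have := rk_dual_ge P J; have := rk_mono P (subvf (orthov J)).
by split; lia.
Qed.

Lemma dual_truncation_independentE C r J : (1 <= r <= \dim C)%N ->
  independent (dual (truncation (code_polymatroid C) (r - 1))) J <->
  (\dim (shorten C J) < r)%N.
Proof.
move=> r_bounds; rewrite dual_independentE /= /trunc_rk /= code_rk_full.
(* The truncated rank of [fullv] is the cap [\dim C - (r - 1)], and [orthov J] reaches it iff
   [\dim (shorten C J) <= r - 1]. *)
rewrite /code_rk orthovK; have := dimvS (shorten_sub C J).
by split; lia.
Qed.

(** Any [r]-dimensional [D] inside [shorten C J] will do; its support may be smaller than [J], hence
    only an inclusion. *)
Lemma leq_dim_shortenP C r J :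
  (r <= \dim (shorten C J))%N <->
  exists2 X, subcode_supports C r X & (X <= J)%VS.
Proof.
split=> [/vspace_of_dim[D] | [_ [D [DC <- <-]] DJ]].
  by rewrite sub_shorten => /andP[DC DJ] dD; exists (Supp D) => //; exists D.
by apply: dimvS; rewrite sub_shorten DC.
Qed.

End HigherSupports.

Theorem theorem3p14 (F : finFieldType) (n m k : nat)
    (n_gt0 : (0 < n)%N) (m_gt0 : (0 < m)%N)
    (C : {vspace 'M[F]_(n, m)}) (dimC : \dim C = k)
    (r : nat) (r_bounds : (1 <= r <= k)%N) :
  forall X : {vspace 'cV[F]_n},
    Min (subcode_supports C r) X <->
    circuit (dual (truncation (code_polymatroid C) (r - 1))) X.
Proof.
move=> X; rewrite -dimC in r_bounds.
have indE J := dual_truncation_independentE F n m C r J r_bounds.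
have supp_dep Y : subcode_supports C r Y -> (r <= \dim (shorten C Y))%N.
  by move=> SY; apply/leq_dim_shortenP; exists Y.
split=> [[SX minX] | [depX indX]].
  split=> [/indE | J JX neJX]; first by rewrite ltnNge supp_dep.
  apply/indE; rewrite ltnNge; apply/negP => /leq_dim_shortenP[Y SY YJ].
  (* Minimality of [X] gives [Y = X], so [X] is squeezed inside [J]. *)
  move/eqP: neJX; apply; apply/eqP; rewrite eqEsubv JX /=.
  by rewrite -(minX Y SY (subv_trans YJ JX)).
have minX Y : subcode_supports C r Y -> (Y <= X)%VS -> Y = X.
  move=> SY YX; apply/eqP/negPn/negP => /(indX Y YX)/indE.
  by rewrite ltnNge supp_dep.
(* A dependent [X] is only known to contain a support [Y]; [minX] then identifies the two, making
   [X] itself a support. *)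
have /leq_dim_shortenP[Y SY YX] : (r <= \dim (shorten C X))%N.
  by rewrite leqNgt; apply/negP => /indE.
by split=> //; rewrite -(minX Y SY YX).
Qed.
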